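(* Let $\mathcal{A}$ be the reflection equation algebra for $n=3$ associated with the Drinfeld $R$-matrix, with generating matrix $$L=\begin{pmatrix} l_1 & a^+ & c^+\\ a^- & l_2 & b^+\\ c^- & b^- & l_3\end{pmatrix},$$ and let $\mathcal{A}_{loc}$ be its localization in which $c^+$ and $l_2-b^+(c^+)^{-1}a^+$ are inverted. In $\mathcal{A}_{loc}$ put $$I_1=c^+,\qquad I_2=l_2-b^+(c^+)^{-1}a^+,\qquad I_3=c^- -(b^-,\,l_3)\begin{pmatrix} a^+ & c^+\\ l_2 & b^+\end{pmatrix}^{-1}\begin{pmatrix} l_1\\ a^-\end{pmatrix},$$ and $Y=I_3I_2I_1$. Then $Y$ lies in the center of $\mathcal{A}$ (that is, $Y$ is the image in $\mathcal{A}_{loc}$ of a central element of $\mathcal{A}$) and is proportional to the quantum determinant $e_3^{(3)}$ of $L$: there is a nonzero scalar $\kappa\in\mathbb{C}$ such that $e_3^{(3)}$ is central in $\mathcal{A}$ and $Y=\kappa\, e_3^{(3)}$ in $\mathcal{A}_{loc}$.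
   Context: The ground field is $\mathbb{C}$ and $q\in\mathbb{C}\setminus\{0\}$. The Drinfeld $R$-matrix for $n=3$ is $$R=\sum_{1\le i<j\le 3}(q-q^{-1})E_{ii}\otimes E_{jj}+\sum_{i,j=1}^{3}q^{\delta_{ij}}E_{ij}\otimes E_{ji}\in Mat_{3\times3}^{\otimes 2},$$ where $E_{ij}$ are the matrix units. The reflection equation algebra $\mathcal{A}$ is the unital associative algebra with nine generators $a_{ij}$ ($1\le i,j\le 3$) and the quadratic relations given by the entries of $$RL_1RL_1=L_1RL_1R \quad\text{in } Mat_{3\times 3}^{\otimes 2}\otimes\mathcal{A},$$ where $L=\sum_{i,j} E_{ij}\otimes a_{ij}$, $L_1=\sum_{i,j} E_{ij}\otimes 1\otimes a_{ij}$, and $R$ stands for $R\otimes 1$. The generators are renamed $a_{11}=l_1$, $a_{22}=l_2$, $a_{33}=l_3$, $a_{12}=a^+$, $a_{13}=c^+$, $a_{23}=b^+$, $a_{21}=a^-$, $a_{31}=c^-$, $a_{32}=b^-$. $\mathcal{A}_{loc}$ is the universal localization of $\mathcal{A}$ obtained by adjoining a two-sided inverse of $c^+$ and then a two-sided inverse of $l_2-b^+(c^+)^{-1}a^+$; elements of $\mathcal{A}$ denote also their images in it. Since $c^+$ and this Schur complement are invertible in $\mathcal{A}_{loc}$, the matrix $\begin{pmatrix} a^+ & c^+\\ l_2 & b^+\end{pmatrix}$ is invertible over $\mathcal{A}_{loc}$, so $I_3$ is defined. The quantum determinant of $L$ is the element of $\mathcal{A}$ given, with $\lambda=q-q^{-1}$,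 by $$e_3^{(3)}=c^+b^-a^-+q^{-2}a^+b^+c^-+\bigl(l_3-\lambda q^{-1}(l_2+q^{-2}l_1)\bigr)e_2^{(2)}-l_1b^+b^--q^{-2}\bigl(l_2-\lambda(q+q^{-1})l_1\bigr)c^+c^-,$$ $$e_2^{(2)}=-a^+a^-+l_1(l_2-\lambda q^{-1}l_1).$$ *)

(* Defs.v *)
From HB Require Import structures.
From mathcomp Require Import all_boot all_order all_algebra.
From mathcomp Require Import generic_quotient ring_quotient.
From mathcomp Require Import finmap.
From mathcomp Require Import boolp classical_sets reals.
From mathcomp.real_closed Require Import complex mxtens.
From mathcomp.multinomials Require Import monalg.

Set Implicit Arguments.
Unset Strict Implicit.
Unset Printing Implicit Defensive.

Import Order.TTheory GRing.Theory Num.Theory.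

Local Open Scope ring_scope.

Definition central (A : pzRingType) (z : A) : Prop :=
  forall x : A, GRing.comm z x.

(* The two-sided inverse of x, and 0 if x has none. It is also used for       *)
(* square matrices over a noncommutative ring, where [invmx] is unavailable.  *)
Definition inv2 (A : pzRingType) (x : A) : A :=
  xget 0 [set y | x * y = 1 /\ y * x = 1]%classic.

Lemma inv2P (A : pzRingType) (x y : A) :
  x * y = 1 -> y * x = 1 -> inv2 x = y.
Proof.
move=> xy yx; rewrite /inv2; case: xgetP => [z _ [xz zx]|/(_ y)[]//].
by rewrite -[z]mulr1 -xy mulrA zx mul1r.
Qed.

Section FreeAlgebra.
Variables (K : comNzRingType) (X : choiceType).

(* The free associative K-algebra on X: the monoid algebra of the free monoid *)
(* of words in X.                                                             *)
Definition freeAlg : Type := {malg K[{fmonom X}]}.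

HB.instance Definition _ := GRing.Lalgebra.on freeAlg.

Definition fgen (x : X) : freeAlg := << fmu x >>.

Fact freeAlg_scalerAr (k : K) (u v : freeAlg) : k *: (u * v) = u * (k *: v).
Proof.
apply/malgP => m.
rewrite mcoeffZ [RHS](mcoeffMlw m (fsubset_refl _) (msuppZ_le k v)).
rewrite [in LHS](mcoeffMl u v) mulr_sumr; apply: eq_bigr => w _.
by rewrite mulr_sumr; apply: eq_bigr => w' _; rewrite mcoeffZ mulrnAr mulrCA.
Qed.

HB.instance Definition _ :=
  GRing.Lalgebra_isAlgebra.Build K freeAlg freeAlg_scalerAr.
End FreeAlgebra.

Section Quotient.
Variables (K : comNzRingType) (F : algType K).

Inductive two_sided_ideal (S : F -> Prop) : F -> Prop :=
| Ideal_gen r of S r : two_sided_ideal S r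
| Ideal_0 : two_sided_ideal S 0
| Ideal_add u v of two_sided_ideal S u & two_sided_ideal S v :
    two_sided_ideal S (u + v)
| Ideal_mull a u of two_sided_ideal S u : two_sided_ideal S (a * u)
| Ideal_mulr a u of two_sided_ideal S u : two_sided_ideal S (u * a).

Variable S : F -> Prop.

Definition ideal_pred (u : F) : bool := `[< two_sided_ideal S u >].

Fact ideal_pred_zmod_closed : zmod_closed ideal_pred.
Proof.
split=> [|u v /asboolP Iu /asboolP Iv]; apply/asboolP; first exact: Ideal_0.
by apply: Ideal_add Iu _; rewrite -mulN1r; apply: Ideal_mull.
Qed.

HB.instance Definition _ :=
  GRing.isZmodClosed.Build F ideal_pred ideal_pred_zmod_closed.

Local Notation quotI := (Quotient.quot (GRing.ZmodClosed.clone F ideal_pred _)).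

(* The quotient of F by the two-sided ideal generated by S.                   *)
Definition quotAlg : Type := quotI.

HB.instance Definition _ := GRing.Zmodule.on quotAlg.

Definition quot_pi (u : F) : quotAlg := \pi_(quotI)%qT u.
Definition quot_repr (x : quotAlg) : F := repr (x : quotI).

Lemma quot_reprK : cancel quot_repr quot_pi. Proof. exact: reprK. Qed.

Lemma quot_piP u v : quot_pi u = quot_pi v <-> two_sided_ideal S (u - v).
Proof.
split=> [/eqP|I]; first by rewrite -Quotient.idealrBE => /asboolP.
by apply/eqP; rewrite -Quotient.idealrBE; apply/asboolP.
Qed.

Fact quot_pi_zmod_morphism : zmod_morphism quot_pi.
Proof. by move=> u v; rewrite /quot_pi raddfB. Qed.

HB.instance Definition _ :=
  GRing.isZmodMorphism.Build F quotAlg quot_pi quot_pi_zmod_morphism.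

Let quot_one := quot_pi 1.
Let quot_mul x y := quot_pi (quot_repr x * quot_repr y).
Let quot_scale (k : K) x := quot_pi (k *: quot_repr x).

Let repr_pi u : two_sided_ideal S (quot_repr (quot_pi u) - u).
Proof. by apply/quot_piP; rewrite quot_reprK. Qed.

Let pi_mul u v : quot_mul (quot_pi u) (quot_pi v) = quot_pi (u * v).
Proof.
apply/quot_piP; set u' := quot_repr _; set v' := quot_repr _.
have -> : u' * v' - u * v = (u' - u) * v' + u * (v' - v).
  by rewrite mulrBl mulrBr addrA subrK.
apply: Ideal_add; [exact/Ideal_mulr/repr_pi|exact/Ideal_mull/repr_pi].
Qed.

Let pi_scale k u : quot_scale k (quot_pi u) = quot_pi (k *: u).
Proof.
apply/quot_piP; rewrite -scalerBr -mulr_algl; exact/Ideal_mull/repr_pi.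
Qed.

Let pi_surj (P : quotAlg -> Prop) : (forall u, P (quot_pi u)) -> forall x, P x.
Proof. by move=> Ppi x; rewrite -[x]quot_reprK. Qed.

Fact quot_mulA : associative quot_mul.
Proof.
by do 3!elim/pi_surj=> ?; rewrite !pi_mul mulrA.
Qed.

Fact quot_mul1x : left_id quot_one quot_mul.
Proof. by elim/pi_surj=> ?; rewrite pi_mul mul1r. Qed.

Fact quot_mulx1 : right_id quot_one quot_mul.
Proof. by elim/pi_surj=> ?; rewrite pi_mul mulr1. Qed.

Fact quot_mulDl : left_distributive quot_mul +%R.
Proof. by do 3!elim/pi_surj=> ?; rewrite -raddfD !pi_mul mulrDl raddfD. Qed.

Fact quot_mulDr : right_distributive quot_mul +%R.
Proof. by do 3!elim/pi_surj=> ?; rewrite -raddfD !pi_mul mulrDr raddfD. Qed.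

HB.instance Definition _ := GRing.Zmodule_isPzRing.Build quotAlg
  quot_mulA quot_mul1x quot_mulx1 quot_mulDl quot_mulDr.

Fact quot_scaleA a b x : quot_scale a (quot_scale b x) = quot_scale (a * b) x.
Proof. by elim/pi_surj: x => u; rewrite !pi_scale scalerA. Qed.

Fact quot_scale1 : left_id 1 quot_scale.
Proof. by elim/pi_surj=> u; rewrite pi_scale scale1r. Qed.

Fact quot_scaleDr : right_distributive quot_scale +%R.
Proof.
by move=> k; do 2!elim/pi_surj=> ?; rewrite -raddfD !pi_scale scalerDr raddfD.
Qed.

Fact quot_scaleDl x : {morph quot_scale^~ x : a b / a + b}.
Proof. by elim/pi_surj: x => u a b; rewrite !pi_scale scalerDl raddfD. Qed.

HB.instance Definition _ := GRing.Zmodule_isLmodule.Build K quotAlg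
  quot_scaleA quot_scale1 quot_scaleDr quot_scaleDl.

Fact quot_pi_monoid_morphism : monoid_morphism quot_pi.
Proof. by split=> // u v; rewrite -pi_mul. Qed.

HB.instance Definition _ :=
  GRing.isMonoidMorphism.Build F quotAlg quot_pi quot_pi_monoid_morphism.

Lemma quot_piZ k u : quot_pi (k *: u) = k *: quot_pi u.
Proof. by rewrite -pi_scale. Qed.

Lemma quot_scalerAl k (x y : quotAlg) : k *: (x * y) = (k *: x) * y.
Proof.
elim/pi_surj: x => u; elim/pi_surj: y => v.
by rewrite -rmorphM -!quot_piZ -rmorphM scalerAl.
Qed.

Lemma quot_scalerAr k (x y : quotAlg) : k *: (x * y) = x * (k *: y).
Proof.
elim/pi_surj: x => u; elim/pi_surj: y => v.
by rewrite -rmorphM -!quot_piZ -rmorphM scalerAr.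
Qed.

Lemma quot_rel u v : S (u - v) -> quot_pi u = quot_pi v.
Proof. by move=> Suv; apply/quot_piP; apply: Ideal_gen. Qed.
End Quotient.

Section Localization.
Variables (A : pzRingType) (s : A).
Local Notation F := (freeAlg int (option A)).
Local Notation gen x := (fgen int (Some (x : A)) : F).
Local Notation t := (fgen int (None : option A) : F).

Inductive loc_rel : F -> Prop :=
| Loc_add x y : loc_rel (gen (x + y) - (gen x + gen y))
| Loc_mul x y : loc_rel (gen (x * y) - gen x * gen y)
| Loc_one : loc_rel (gen 1 - 1)
| Loc_mulV : loc_rel (gen s * t - 1)
| Loc_Vmul : loc_rel (t * gen s - 1).

(* The universal localization of the ring A obtained by freely adjoining a    *)
(* two-sided inverse t of s: the free ring on A and t, modulo the relations   *)
(* making A -> loc a unital ring morphism and t an inverse of s. When A is a  *)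
(* K-algebra so is loc, through K -> A -> loc.                                *)
Definition loc : Type := quotAlg loc_rel.

HB.instance Definition _ := GRing.PzRing.on loc.

Definition loc_emb (x : A) : loc := quot_pi loc_rel (gen x).

Fact loc_emb_add : {morph loc_emb : x y / x + y}.
Proof.
move=> x y; rewrite /loc_emb -[RHS](raddfD (quot_pi loc_rel)).
exact/quot_rel/Loc_add.
Qed.

Fact loc_emb_zmod_morphism : zmod_morphism loc_emb.
Proof.
move=> x y; apply/eqP.
by rewrite eq_sym subr_eq -loc_emb_add subrK.
Qed.

Fact loc_emb_monoid_morphism : monoid_morphism loc_emb.
Proof.
split=> [|x y]; first exact: (quot_rel Loc_one).
rewrite /loc_emb -[RHS](rmorphM (quot_pi loc_rel)).
exact/quot_rel/Loc_mul.
Qed.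

HB.instance Definition _ :=
  GRing.isZmodMorphism.Build A loc loc_emb loc_emb_zmod_morphism.
HB.instance Definition _ :=
  GRing.isMonoidMorphism.Build A loc loc_emb loc_emb_monoid_morphism.

Lemma loc_emb_inv :
  loc_emb s * inv2 (loc_emb s) = 1 /\ inv2 (loc_emb s) * loc_emb s = 1.
Proof.
pose y : loc := quot_pi loc_rel t.
have sy : loc_emb s * y = 1.
  by rewrite -[LHS](rmorphM (quot_pi loc_rel)); exact: (quot_rel Loc_mulV).
have ys : y * loc_emb s = 1.
  by rewrite -[LHS](rmorphM (quot_pi loc_rel)); exact: (quot_rel Loc_Vmul).
by rewrite (inv2P sy ys).
Qed.
End Localization.

(* For a 3 x 3 matrix L with the entries                                      *)
(*     l_1 a^+ c^+ / a^- l_2 b^+ / c^- b^- l_3                                *)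
(* over a noncommutative ring. Rows and columns are numbered from 0.          *)
Section Minors.
Variables (B : pzRingType) (L : 'M[B]_3).

Definition I1 : B := L 0 2.

Definition I2 : B := L 1 1 - L 1 2 * inv2 (L 0 2) * L 0 1.

Definition I3_block : 'M[B]_(1 + 1) :=
  block_mx (L 0 1)%:M (L 0 2)%:M
           (L 1 1)%:M (L 1 2)%:M.

Definition I3 : B :=
  L 2 0 - ((row_mx (L 2 1)%:M (L 2 2)%:M : 'M_(1, 1 + 1)) *m inv2 I3_block
             *m (col_mx (L 0 0)%:M (L 1 0)%:M : 'M_(1 + 1, 1))) 0 0.

Definition Y : B := I3 * I2 * I1.

Lemma I3_block_inv (u v : B) :
    L 0 2 * u = 1 -> u * L 0 2 = 1 -> I2 * v = 1 -> v * I2 = 1 ->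
  I3_block *m inv2 I3_block = 1%:M /\ inv2 I3_block *m I3_block = 1%:M.
Proof.
move=> cu uc; rewrite /I2 (inv2P cu uc) /I3_block.
move: (L 0 1) (L 0 2) (L 1 1) (L 1 2) cu uc => a c l b cu uc sv vs.
pose N : 'M[B]_(1 + 1) :=
  block_mx (- (v * b * u))%:M v%:M
           (u + u * a * v * b * u)%:M (- (u * a * v))%:M.
have lv : l * v = 1 + b * u * a * v.
  by rewrite -sv mulrBl subrK.
have vl : v * l = 1 + v * b * u * a.
  by rewrite -vs mulrBr !mulrA subrK.
suff [MN NM] : block_mx a%:M c%:M l%:M b%:M *m N = 1%:M /\
               N *m block_mx a%:M c%:M l%:M b%:M = 1%:M.
  by rewrite (inv2P MN NM).
have E1 : 1%:M = block_mx 1%:M 0%:M 0%:M 1%:M :> 'M[B]_(1 + 1).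
  by rewrite raddf0 -scalar_mx_block.
split; rewrite mulmx_block -!scalar_mxM -!raddfD E1 /=; congr block_mx;
  congr scalar_mx.
- by rewrite mulrDr !mulrA cu mulrN !mulrA mul1r addrCA addNr addr0.
- by rewrite mulrN !mulrA cu mul1r subrr.
- by rewrite mulrN mulrDr !mulrA lv !mulrDl !mul1r addNr.
- by rewrite mulrN !mulrA lv addrK.
- by rewrite mulNr vl addrC addrK.
- by rewrite mulNr -!mulrA uc mulr1 addNr.
- by rewrite mulNr -(mulrA (u * a) v l) vl mulrDr mulr1 mulrDl !mulrA subrr.
- by rewrite mulNr mulrDl -!mulrA uc mulr1 addrK.
Qed.
End Minors.

Section ReflectionEquationAlgebra.
Variables (K : fieldType) (q : K).

Definition drinfeldR : 'M[K]_(3 * 3) :=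
  \sum_(i < 3) \sum_(j < 3 | (i < j)%N)
     (q - q^-1) *: (delta_mx i i *t delta_mx j j)
  + \sum_(i < 3) \sum_(j < 3)
     q ^+ (i == j) *: (delta_mx i j *t delta_mx j i).

(* R L_1 R L_1 - L_1 R L_1 R, where L_1 = L (x) 1 and the scalar matrix R is   *)
(* mapped into the coefficient algebra A.                                     *)
Definition re_defect (A : algType K) (L : 'M[A]_3) : 'M[A]_(3 * 3) :=
  let R := map_mx (in_alg A) drinfeldR in
  let L1 := L *t (1%:M : 'M_3) in
  R *m L1 *m R *m L1 - L1 *m R *m L1 *m R.

Local Notation F := (freeAlg K ('I_3 * 'I_3)%type).

Definition freeL : 'M[F]_3 := \matrix_(i, j) fgen K (i, j).

Definition re_rel (u : F) : Prop := exists i j, u = re_defect freeL i j.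

Definition reAlg : Type := quotAlg re_rel.

HB.instance Definition _ := GRing.PzRing.on reAlg.
HB.instance Definition _ := GRing.Lmodule.on reAlg.

Fact reAlg_nonzero : (1 : reAlg) != 0.
Proof.
pose M : monomType := {fmonom ('I_3 * 'I_3)%type}.
pose eps : {rmorphism {malg K[M]} -> K} := @mcoeff M K mone.
suff eps0 u : two_sided_ideal re_rel u -> eps u = 0.
  apply/eqP => e; have /quot_piP : quot_pi re_rel 1 = quot_pi re_rel 0.
    by rewrite rmorph0 rmorph1.
  by rewrite subr0 => /eps0/eqP; rewrite rmorph1 oner_eq0.
elim=> {u} [u [i [j ->]]||u v _ u0 _ v0|a u _ u0|a u _ u0].
- have L10 : map_mx eps (freeL *t (1%:M : 'M_3)) = 0.
    apply/matrixP => k l; rewrite !mxE rmorphM.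
    by rewrite [eps (fgen _ _)]mcoeffU fm1_eq1; exact: mul0r.
  rewrite /re_defect /=.
  move: (map_mx _ drinfeldR) (freeL *t _) L10 => R L1 L10.
  have U0 : map_mx eps (R *m L1 *m R *m L1) = 0.
    by rewrite map_mxM L10 mulmx0.
  have V0 : map_mx eps (L1 *m R *m L1 *m R) = 0.
    by rewrite !(map_mxM, L10, mul0mx).
  have sub0 (U V : 'M_(3 * 3)) :
      map_mx eps U = 0 -> map_mx eps V = 0 -> eps ((U - V) i j) = 0.
    move=> /matrixP/(_ i j) Uij /matrixP/(_ i j) Vij.
    rewrite !mxE in Uij Vij.
    by rewrite mxE [X in _ + X]mxE [LHS]rmorphB Uij Vij subrr.
  exact: sub0 U0 V0.
- exact: rmorph0.
- by rewrite [LHS]rmorphD u0 v0 addr0.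
- by rewrite [LHS]rmorphM u0 mulr0.
- by rewrite [LHS]rmorphM u0 mul0r.
Qed.

HB.instance Definition _ := GRing.PzSemiRing_isNonZero.Build reAlg reAlg_nonzero.
HB.instance Definition _ :=
  GRing.Lmodule_isLalgebra.Build K reAlg (@quot_scalerAl _ _ re_rel).
HB.instance Definition _ :=
  GRing.Lalgebra_isAlgebra.Build K reAlg (@quot_scalerAr _ _ re_rel).

Definition reL : 'M[reAlg]_3 := \matrix_(i, j) quot_pi re_rel (fgen K (i, j)).

Definition qdet (A : algType K) (L : 'M[A]_3) : A :=
  let l1 := L 0 0 in let l2 := L 1 1 in let l3 := L 2 2 in
  let ap := L 0 1 in let cp := L 0 2 in let bp := L 1 2 in
  let am := L 1 0 in let cm := L 2 0 in let bm := L 2 1 in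
  let lambda := q - q^-1 in
  let e2 := - (ap * am) + l1 * (l2 - (lambda * q^-1) *: l1) in
  cp * bm * am + q ^- 2 *: (ap * bp * cm)
  + (l3 - (lambda * q^-1) *: (l2 + q ^- 2 *: l1)) * e2
  - l1 * bp * bm
  - q ^- 2 *: ((l2 - (lambda * (q + q^-1)) *: l1) * cp * cm).

(* c^+ is inverted first, then the image of l_2 - b^+ (c^+)^-1 a^+.           *)
Definition reAlg1 : pzRingType := loc (I1 reL).
Definition reL1 : 'M[reAlg1]_3 := map_mx (loc_emb (I1 reL)) reL.

Definition reAlgloc : pzRingType := loc (I2 reL1).

Definition re_emb : reAlg -> reAlgloc :=
  loc_emb (I2 reL1) \o loc_emb (I1 reL).

HB.instance Definition _ := GRing.RMorphism.on re_emb.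
End ReflectionEquationAlgebra.

Arguments re_emb {K} q _.

(* Main.v *)
Require Import Defs.
From mathcomp Require Import all_boot all_order all_algebra.
From mathcomp Require Import ring.
From mathcomp Require Import reals.
From mathcomp.real_closed Require Import complex mxtens.
From mathcomp.multinomials Require monalg.

Set Implicit Arguments.
Unset Strict Implicit.
Unset Printing Implicit Defensive.

Import GRing.Theory.

Local Open Scope ring_scope.

(* Quantum Cramer's rule for the block matrix in I_3. With                    *)
(*   D = l_2 c^+ - q^-1 b^+ a^+,  M = a^- c^+ - q^-2 b^+ l_1,                 *)
(*   P = q^-2 e_2^(2),                                                        *)
(* one has in A itself D = I_2 I_1 (since a^+ c^+ = q^-1 c^+ a^+) and         *)
(*   a^+ M + c^+ P = l_1 D,  l_2 M + b^+ P = a^- D,                           *)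
(* so that the block matrix inverse sends (l_1, a^-)^T D to (M, P)^T, whence  *)
(*   Y = I_3 D = c^- D - b^- M - l_3 P = - q^2 e_3^(3).                       *)
(* The identities in A, including the centrality of e_3^(3), are obtained by  *)
(* noncommutative division by the entries of the reflection equation: for the *)
(* row-major order of the a_ij and the lexicographic order of words, the      *)
(* 36 products x y with x > y all occur as leading words of entries, with     *)
(* coefficients +-q^k, so that the division is valid for every q != 0.        *)

(** Because Y = I_3 (I_2 I_1) = I_3 D, the matrix inverse in I_3 only ever meets the column (l_1,
    a^-)^T D, which Cramer's rule writes as the block matrix applied to (M, P)^T. [Y_cramer]
    performs this cancellation in any ring where I_1 and I_2 are invertible. Its inputs
    [entry01_entry02], [cramer_row0] and [cramer_row1], and the expansion [qdet_cramer], are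
    identities of A carried to the localization by a ring morphism. For the center, [qdet_comm]
    treats the generators and [reAlg_central] passes to all of A. *)

(** * Noncommutative polynomials over Z[q, q^-1] *)

(* A pair (c, e) stands for c q^e.                                           *)
Definition laurent := seq (int * int).
Definition word := seq nat.
Definition ncterm := ((int * int) * word)%type.
Definition ncpoly := seq ncterm.

(** Like terms merge and cancel at insertion. This is how [nc_reduce] gets rid of the term being
    divided, and why zero can be recognised as [[::]]. *)
Fixpoint nc_cons (t : ncterm) (p : ncpoly) : ncpoly :=
  match p with
  | [::] => [:: t]
  | t' :: p' =>
    if (t.2 == t'.2) && (t.1.2 == t'.1.2) then
      if t.1.1 + t'.1.1 == 0 then p'
      else ((t.1.1 + t'.1.1, t.1.2), t.2) :: p'
    else t' :: nc_cons t p'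
  end.

Definition nc_add (p r : ncpoly) : ncpoly := foldr nc_cons r p.

Definition nc_shift (k : int * int) (u : word) (p : ncpoly) (v : word) :=
  [seq ((k.1 * t.1.1, k.2 + t.1.2), u ++ t.2 ++ v) | t <- p].

Definition nc_scale (s : laurent) (p : ncpoly) : ncpoly :=
  foldr (fun k => nc_add (nc_shift k [::] p [::])) [::] s.

Definition nc_mul (p r : ncpoly) : ncpoly :=
  foldr (fun t => nc_add (nc_shift t.1 t.2 r [::])) [::] p.

Definition nc_opp (p : ncpoly) : ncpoly := nc_shift (-1, 0) [::] p [::].
Definition nc_gen (i : nat) : ncpoly := [:: ((1, 0), [:: i])].

Fixpoint lexlt (u v : word) : bool :=
  match u, v with
  | x :: u', y :: v' => (x < y)%N || ((x == y) && lexlt u' v')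
  | [::], _ :: _ => true
  | _, _ => false
  end.

(** A zero entry gets the empty word, which matches no factor of length 2. *)
Definition nc_lead (p : ncpoly) : ncterm :=
  foldr (fun t m => if lexlt m.2 t.2 then t else m) ((0, 0), [::]) p.

Definition nc_rules : Type := seq (ncterm * ncpoly).

(* The leading words are quadratic, so a redex is a factor of length 2.       *)
Fixpoint nc_redex (rs : nc_rules) (u w : word) :
    option (word * (ncterm * ncpoly) * word) :=
  match w with
  | x :: ((y :: v) as w') =>
    match [seq r <- rs | r.1.2 == [:: x; y]] with
    | r :: _ => Some (rev u, r, v)
    | [::] => nc_redex rs (x :: u) w'
    end
  | _ => None
  end.

(* The leading coefficient (c, e) of a rule is inverted as (c, - e), which is *)
(* correct for c = +-1. The value is unchanged modulo the relations whatever  *)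
(* the leading terms are, so nothing has to be checked about them.            *)
Fixpoint nc_reduce (rs : nc_rules) (n : nat) (todo done : ncpoly) :=
  if n isn't n'.+1 then nc_add todo done else
  match todo with
  | [::] => done
  | t :: todo' =>
    match nc_redex rs [::] t.2 with
    | Some (u, r, v) =>
      let l := r.1.1 in
      nc_reduce rs n'
        (nc_add (nc_shift (- (t.1.1 * l.1), t.1.2 - l.2) u r.2 v) todo) done
    | None => nc_reduce rs n' todo' (nc_cons t done)
    end
  end.

(** The table is built before the indices are supplied, so that under evaluation by value each entry
    is computed once. *)
Definition nc_table (F : nat -> nat -> ncpoly) : nat -> nat -> ncpoly :=
  let T := mkseq (fun s => mkseq (F s) 9) 9 in
  fun s t => nth [::] (nth [::] T s) t.

Definition nc_mxmul (F G : nat -> nat -> ncpoly) : nat -> nat -> ncpoly :=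
  nc_table (fun s t =>
    foldr (fun k => nc_add (nc_mul (F s k) (G k t))) [::] (iota 0 9)).

(** * Soundness of formal division under evaluation *)

Section Eval.
Variables (K : fieldType) (q : K) (hq : q != 0) (A : algType K) (g : nat -> A).

Definition lval (s : laurent) : K := \sum_(k <- s) k.1%:~R * q ^ k.2.

Definition nc_teval (t : ncterm) : A :=
  (t.1.1%:~R * q ^ t.1.2) *: \prod_(x <- t.2) g x.

Definition nc_eval (p : ncpoly) : A := \sum_(t <- p) nc_teval t.

Lemma nc_eval_nil : nc_eval [::] = 0. Proof. exact: big_nil. Qed.

Lemma nc_evalE t p : nc_eval (t :: p) = nc_teval t + nc_eval p.
Proof. exact: big_cons. Qed.

Lemma nc_eval_cons t p : nc_eval (nc_cons t p) = nc_teval t + nc_eval p.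
Proof.
rewrite /nc_eval; elim: p => [|t' p IH] /=.
  by rewrite big_seq1 big_nil addr0.
case: ifP => [/andP[/eqP e1 /eqP e2]|_]; last by rewrite !big_cons IH addrCA.
rewrite big_cons addrA; have -> : nc_teval t + nc_teval t' =
   nc_teval ((t.1.1 + t'.1.1, t.1.2), t.2).
  by rewrite /nc_teval /= -e1 -e2 -scalerDl -mulrDl rmorphD.
by case: eqP => [->|_]; rewrite ?big_cons // /nc_teval /= mul0r scale0r add0r.
Qed.

Lemma nc_evalD p r : nc_eval (nc_add p r) = nc_eval p + nc_eval r.
Proof.
elim: p => [|t p IH]; first by rewrite /nc_eval big_nil add0r.
by rewrite /= nc_eval_cons IH addrA -nc_evalE.
Qed.

Lemma nc_eval_shift k u p v : nc_eval (nc_shift k u p v) =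
  (k.1%:~R * q ^ k.2) *: (\prod_(x <- u) g x * nc_eval p * \prod_(x <- v) g x).
Proof.
rewrite /nc_eval big_map mulr_sumr mulr_suml scaler_sumr; apply: eq_bigr => t _.
rewrite /nc_teval /= !big_cat /= rmorphM /= expfzDr //.
by rewrite -scalerAr -scalerAl scalerA !mulrA; congr (_ *: _); ring.
Qed.

Lemma nc_evalZ s p : nc_eval (nc_scale s p) = lval s *: nc_eval p.
Proof.
rewrite /lval; elim: s => [|k s IH] /=.
  by rewrite /nc_eval !big_nil scale0r.
by rewrite nc_evalD IH nc_eval_shift !big_nil big_cons mulr1 mul1r scalerDl.
Qed.

Lemma nc_evalM p r : nc_eval (nc_mul p r) = nc_eval p * nc_eval r.
Proof.
elim: p => [|t p IH] /=; first by rewrite /nc_eval !big_nil mul0r.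
rewrite nc_evalD IH nc_eval_shift big_nil mulr1.
by rewrite nc_evalE mulrDl -scalerAl.
Qed.

Lemma nc_evalN p : nc_eval (nc_opp p) = - nc_eval p.
Proof. by rewrite nc_eval_shift !big_nil mul1r !mulr1 scaleN1r. Qed.

Lemma nc_eval_gen i : nc_eval (nc_gen i) = g i.
Proof. by rewrite /nc_eval big_seq1 /nc_teval big_seq1 mulr1 scale1r. Qed.

Lemma nc_redex_mem rs u w u' r v :
  nc_redex rs u w = Some (u', r, v) -> r \in rs.
Proof.
elim: w u => [|x [|y w] IH] //= u.
case E: [seq _ <- _ | _] => [|r' s]; [exact: IH|].
have: r' \in r' :: s by rewrite mem_head.
by rewrite -E mem_filter => /andP[_ r'rs] [_ <- _].
Qed.

(** Each step either moves a term or adds a two-sided multiple of a rule, whose value is zero; when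
    the fuel [n] runs out, the remaining terms are still summed. *)
Lemma nc_eval_reduce rs n p r :
    (forall r', r' \in rs -> nc_eval r'.2 = 0) ->
  nc_eval (nc_reduce rs n p r) = nc_eval p + nc_eval r.
Proof.
move=> rs0; elim: n p r => [|n IH] p r /=; first exact: nc_evalD.
case: p => [|t p]; first by rewrite nc_eval_nil add0r.
case E: (nc_redex _ _ _) => [[[u r'] v]|].
  rewrite IH nc_evalD nc_eval_shift (rs0 _ (nc_redex_mem E)).
  by rewrite mulr0 mul0r scaler0 add0r.
by rewrite IH nc_eval_cons nc_evalE addrCA addrA.
Qed.

Lemma nc_eval_eq rs n p r : (forall r', r' \in rs -> nc_eval r'.2 = 0) ->
  nc_reduce rs n (nc_add p (nc_opp r)) [::] = [::] -> nc_eval p = nc_eval r.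
Proof.
move=> rs0 e; have := nc_eval_reduce n (nc_add p (nc_opp r)) [::] rs0.
rewrite e nc_eval_nil addr0 nc_evalD nc_evalN => /esym/eqP.
by rewrite subr_eq0 => /eqP.
Qed.

Definition nc_mx (F : nat -> nat -> ncpoly) : 'M[A]_(3 * 3) :=
  \matrix_(s, t) nc_eval (F s t).

Lemma nc_mxM F G : nc_mx (nc_mxmul F G) = nc_mx F *m nc_mx G.
Proof.
apply/matrixP => s t; rewrite !mxE /nc_mxmul /nc_table !nth_mkseq //.
under eq_bigr do rewrite !mxE -nc_evalM.
rewrite -(big_mkord xpredT (fun k => nc_eval (nc_mul (F s k) (G k t)))).
rewrite /index_iota subn0.
elim: (iota 0 9) => [|k l IH] /=; first by rewrite /nc_eval !big_nil.
by rewrite nc_evalD IH big_cons.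
Qed.
End Eval.

(** * The relations of the reflection equation *)

(* Row [s] of a 9 x 9 matrix stands for the pair of indices (s / 3, s mod 3), *)
(* as in [mxtens_unindex]; the letter 3 i + j stands for the entry L i j.     *)
Definition nc_R (s t : nat) : ncpoly :=
  let i := (s %/ 3)%N in let j := (s %% 3)%N in
  let k := (t %/ 3)%N in let l := (t %% 3)%N in
  nc_add
    (if [&& i == k, j == l & (i < j)%N]
     then [:: ((1, 1), [::]); ((-1, -1), [::])] else [::])
    (if (i == l) && (j == k) then [:: ((1, (i == j)%:Z), [::])] else [::]).

Definition nc_L1 (s t : nat) : ncpoly :=
  if (s %% 3 == t %% 3)%N then nc_gen (3 * (s %/ 3) + t %/ 3) else [::].

Definition nc_re_defects : seq ncpoly :=
  let U := nc_mxmul (nc_mxmul (nc_mxmul nc_R nc_L1) nc_R) nc_L1 in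
  let V := nc_mxmul (nc_mxmul (nc_mxmul nc_L1 nc_R) nc_L1) nc_R in
  allpairs (fun s t => nc_add (U s t) (nc_opp (V s t))) (iota 0 9) (iota 0 9).

Definition nc_re_rules : nc_rules := [seq (nc_lead r, r) | r <- nc_re_defects].

Section ReflectionEquation.
Variables (K : fieldType) (q : K) (hq : q != 0) (A : algType K) (L : 'M[A]_3).

Definition nc_entry (k : nat) : A := L (inord (k %/ 3)) (inord (k %% 3)).

Notation ev := (nc_eval q nc_entry).

(** At most one summand of each sum survives: the only nonzero entry of E_ii (x) E_jj is at row and
    column (i, j), that of E_ij (x) E_ji at row (i, j) and column (j, i). *)
Lemma drinfeldRE (i j k l : 'I_3) :
  drinfeldR q (mxtens_index (i, j)) (mxtens_index (k, l)) =
  (if [&& i == k, j == l & (i < j)%N] then q - q^-1 else 0) +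
  (if (i == l) && (j == k) then q ^+ (i == j) else 0).
Proof.
rewrite /drinfeldR mxE !summxE; congr (_ + _).
  rewrite (bigD1 i) //= summxE [X in _ + X]big1 => [|a /negPf ai]; last first.
    rewrite summxE big1 // => b _.
    by rewrite !mxE !mxtens_indexK /= (eq_sym i) ai mul0r mulr0.
  case: ifP => [/and3P[/eqP <- /eqP <- ij]|nij].
    rewrite (bigD1 j) //= big1 => [|b /andP[_ /negPf bj]].
      by rewrite !mxE !mxtens_indexK /= !eqxx !mulr1 !addr0.
    by rewrite !mxE !mxtens_indexK /= (eq_sym j) bj !mulr0.
  rewrite big1 ?addr0 // => b ib; rewrite !mxE !mxtens_indexK /=.
  case: (eqVneq j b) => [jb|]; last by rewrite !mulr0.
  case: (eqVneq i k) nij => [ik|]; last by rewrite eqxx mul0r mulr0.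
  case: (eqVneq l b) => [lb|]; last by rewrite !mulr0.
  by rewrite jb lb eqxx ib.
rewrite (bigD1 i) //= summxE [X in _ + X]big1 => [|a /negPf ai]; last first.
  rewrite summxE big1 // => b _.
  by rewrite !mxE !mxtens_indexK /= (eq_sym i) ai mul0r mulr0.
rewrite (bigD1 j) //= [X in _ + X + _]big1 => [|b /negPf bj]; last first.
  by rewrite !mxE !mxtens_indexK /= (eq_sym j) bj !mulr0.
rewrite !mxE !mxtens_indexK /= !eqxx !addr0 /= (eq_sym k) (eq_sym l) /=.
by case: (j == k); case: (i == l); rewrite ?mulr1 ?mulr0.
Qed.

Lemma nc_mx_indexP (F : nat -> nat -> ncpoly) (M : 'M[A]_(3 * 3)) :
    (forall i j k l : 'I_3, ev (F (i * 3 + j)%N (k * 3 + l)%N) =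
       M (mxtens_index (i, j)) (mxtens_index (k, l))) ->
  nc_mx q nc_entry F = M.
Proof.
move=> FM; apply/matrixP => s t; rewrite mxE.
by case: (mxtens_indexP s) => i j; case: (mxtens_indexP t) => k l; apply: FM.
Qed.

Lemma nc_mxR : nc_mx q nc_entry nc_R = map_mx (in_alg A) (drinfeldR q).
Proof.
apply: nc_mx_indexP => i j k l; rewrite mxE drinfeldRE /nc_R.
rewrite !divnMDl // !modnMDl !modn_small // !divn_small // !addn0.
rewrite nc_evalD rmorphD; congr (_ + _).
  have -> : [&& i == k :> nat, j == l :> nat & (i < j)%N] =
            [&& i == k, j == l & (i < j)%N] by [].
  case: ifP => _; last by rewrite nc_eval_nil rmorph0.
  rewrite !nc_evalE nc_eval_nil /nc_teval !big_nil /= addr0 -scalerDl.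
  by rewrite mul1r mulN1r.
have -> : (i == l :> nat) && (j == k :> nat) = (i == l) && (j == k) by [].
case: ifP => _; last by rewrite nc_eval_nil rmorph0.
by rewrite !nc_evalE nc_eval_nil /nc_teval !big_nil /= addr0 mul1r.
Qed.

Lemma nc_mxL1 : nc_mx q nc_entry nc_L1 = L *t (1%:M : 'M_3).
Proof.
apply: nc_mx_indexP => i j k l; rewrite tensmxE mxE /nc_L1.
rewrite !divnMDl // !modnMDl !modn_small // !divn_small // !addn0.
have -> : (j == l :> nat) = (j == l) by [].
case: eqP => _; last by rewrite nc_eval_nil mulr0.
rewrite nc_eval_gen mulr1 /nc_entry mulnC divnMDl // modnMDl modn_small //.
by rewrite divn_small // addn0 !inord_val.
Qed.

Hypothesis re : re_defect q L = 0.

(** Evaluation respects matrix products, so the formally computed rules evaluate to the entries of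
    [re_defect q L]. *)
Lemma nc_re_rules0 r : r \in nc_re_rules -> ev r.2 = 0.
Proof.
case/mapP => p /allpairsP[[s t] [s9 t9 ->] ->].
rewrite !mem_iota /= in s9 t9.
have /matrixP/(_ (Ordinal s9) (Ordinal t9)) := re.
rewrite /re_defect -nc_mxR -nc_mxL1 -!nc_mxM // [RHS]mxE => <-.
by rewrite nc_evalD nc_evalN // !mxE.
Qed.

(** The fuel 1000 suffices for all the identities below; too little fuel could only make the check
    fail. *)
Lemma nc_re_eq p r :
  nc_reduce nc_re_rules 1000 (nc_add p (nc_opp r)) [::] = [::] -> ev p = ev r.
Proof. by apply: nc_eval_eq nc_re_rules0. Qed.
End ReflectionEquation.

(** * Quantum Cramer's rule *)

Section Cramer.
Variables (K : fieldType) (q : K) (A : algType K) (L : 'M[A]_3).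

Let lambda := q - q^-1.
Let e2 := - (L 0 1 * L 1 0) + L 0 0 * (L 1 1 - (lambda * q^-1) *: L 0 0).

(** At q = 1 these three are, up to a common sign, the determinant of the block matrix of I_3 and
    the two Cramer numerators for the column (l_1, a^-). *)
Definition minorD : A := L 1 1 * L 0 2 - L 1 2 * (q^-1 *: L 0 1).
Definition minorM : A := L 1 0 * L 0 2 - L 1 2 * (q ^- 2 *: L 0 0).
Definition minorP : A := q ^- 2 *: e2.

Hypotheses (hq : q != 0) (re : re_defect q L = 0).

Local Notation ev := (nc_eval q (nc_entry L)).

Let lambdaq := [:: (1, 0); (-1, -2)] : laurent.
Let nc_e2 := nc_add (nc_opp (nc_mul (nc_gen 1) (nc_gen 3)))
  (nc_mul (nc_gen 0)
     (nc_add (nc_gen 4) (nc_opp (nc_scale lambdaq (nc_gen 0))))).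
Let nc_D := nc_add (nc_mul (nc_gen 4) (nc_gen 2))
  (nc_opp (nc_mul (nc_gen 5) (nc_scale [:: (1, -1)] (nc_gen 1)))).
Let nc_M := nc_add (nc_mul (nc_gen 3) (nc_gen 2))
  (nc_opp (nc_mul (nc_gen 5) (nc_scale [:: (1, -2)] (nc_gen 0)))).
Let nc_P := nc_scale [:: (1, -2)] nc_e2.
Let nc_qdet :=
  nc_add (nc_add (nc_add (nc_add
    (nc_mul (nc_mul (nc_gen 2) (nc_gen 7)) (nc_gen 3))
    (nc_scale [:: (1, -2)] (nc_mul (nc_mul (nc_gen 1) (nc_gen 5)) (nc_gen 6))))
    (nc_mul (nc_add (nc_gen 8)
       (nc_opp (nc_scale lambdaq
          (nc_add (nc_gen 4) (nc_scale [:: (1, -2)] (nc_gen 0)))))) nc_e2))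
    (nc_opp (nc_mul (nc_mul (nc_gen 0) (nc_gen 5)) (nc_gen 7))))
    (nc_opp (nc_scale [:: (1, -2)] (nc_mul (nc_mul
       (nc_add (nc_gen 4) (nc_opp (nc_scale [:: (1, 2); (-1, -2)] (nc_gen 0))))
       (nc_gen 2)) (nc_gen 6)))).

Let ev_gen (i j : 'I_3) k : k = (3 * i + j)%N -> ev (nc_gen k) = L i j.
Proof.
move=> ->; rewrite nc_eval_gen /nc_entry mulnC divnMDl // modnMDl modn_small //.
by rewrite divn_small // addn0 !inord_val.
Qed.

Let evG := (@ev_gen 0 0 0 erefl, @ev_gen 0 1 1 erefl, @ev_gen 0 2 2 erefl,
  @ev_gen 1 0 3 erefl, @ev_gen 1 1 4 erefl, @ev_gen 1 2 5 erefl,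
  @ev_gen 2 0 6 erefl, @ev_gen 2 1 7 erefl, @ev_gen 2 2 8 erefl).

Let lval_q n : lval q [:: (1, n)] = q ^ n.
Proof. by rewrite /lval big_seq1 mul1r. Qed.

Let lval_lambdaq : lval q lambdaq = lambda * q^-1.
Proof.
rewrite /lval big_cons big_seq1 /= mul1r expr0z mulN1r.
rewrite (_ : q ^ (-2) = q ^- 2) //.
by rewrite mulrBl mulfV // -expr2 exprVn.
Qed.

Let lval_lambda2 : lval q [:: (1, 2); (-1, -2)] = lambda * (q + q^-1).
Proof.
rewrite /lval big_cons big_seq1 /= mul1r mulN1r (_ : q ^ (-2) = q ^- 2) //.
by rewrite -subr_sqr exprVn.
Qed.

Let evE := (nc_evalD, lval_q, nc_evalN, nc_evalM, nc_evalZ, evG,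
  lval_lambdaq, lval_lambda2).

Let ev_e2 : ev nc_e2 = e2.
Proof. by rewrite /nc_e2 !evE. Qed.

Let ev_qdet : ev nc_qdet = qdet q L.
Proof. by rewrite /nc_qdet !(evE, ev_e2). Qed.

Let ev_D : ev nc_D = minorD. Proof. by rewrite /nc_D !evE. Qed.
Let ev_M : ev nc_M = minorM. Proof. by rewrite /nc_M !evE. Qed.
Let ev_P : ev nc_P = minorP. Proof. by rewrite /nc_P !(evE, ev_e2). Qed.

Let evEE := (evE, ev_D, ev_M, ev_P, ev_qdet).

Lemma cramer_row0 : L 0 1 * minorM + L 0 2 * minorP = L 0 0 * minorD.
Proof.
suff: ev (nc_add (nc_mul (nc_gen 1) nc_M) (nc_mul (nc_gen 2) nc_P)) =
      ev (nc_mul (nc_gen 0) nc_D) by rewrite !evEE.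
by apply: nc_re_eq => //; vm_compute.
Qed.

Lemma cramer_row1 : L 1 1 * minorM + L 1 2 * minorP = L 1 0 * minorD.
Proof.
suff: ev (nc_add (nc_mul (nc_gen 4) nc_M) (nc_mul (nc_gen 5) nc_P)) =
      ev (nc_mul (nc_gen 3) nc_D) by rewrite !evEE.
by apply: nc_re_eq => //; vm_compute.
Qed.

(** A quantum Laplace expansion along the last row; at q = 1 both sides are minus the determinant of
    L. *)
Lemma qdet_cramer :
  L 2 0 * minorD - (L 2 1 * minorM + L 2 2 * minorP) = - q ^+ 2 *: qdet q L.
Proof.
suff: ev (nc_add (nc_mul (nc_gen 6) nc_D) (nc_opp (nc_add
        (nc_mul (nc_gen 7) nc_M) (nc_mul (nc_gen 8) nc_P)))) =
      ev (nc_opp (nc_scale [:: (1, 2)] nc_qdet)).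
  by rewrite !evEE // => ->; rewrite scaleNr.
by apply: nc_re_eq => //; vm_compute.
Qed.

Lemma entry01_entry02 : L 0 1 * L 0 2 = L 0 2 * (q^-1 *: L 0 1).
Proof.
suff: ev (nc_mul (nc_gen 1) (nc_gen 2)) =
      ev (nc_mul (nc_gen 2) (nc_scale [:: (1, -1)] (nc_gen 1))).
  by rewrite !evEE.
by apply: nc_re_eq => //; vm_compute.
Qed.

(** Nine formal identities, one per letter, checked by division in one evaluation. *)
Lemma qdet_comm i j : GRing.comm (qdet q L) (L i j).
Proof.
have com k : (k < 9)%N -> GRing.comm (ev nc_qdet) (ev (nc_gen k)).
  move=> k9; rewrite /GRing.comm -!nc_evalM //.
  apply: nc_re_eq => //; apply/eqP.
  suff /allP: all (fun k => nc_reduce nc_re_rules 1000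
     (nc_add (nc_mul nc_qdet (nc_gen k)) (nc_opp (nc_mul (nc_gen k) nc_qdet)))
     [::] == [::]) (iota 0 9).
    by apply; rewrite mem_iota.
  by vm_compute.
rewrite -ev_qdet -(ev_gen erefl); apply: com.
rewrite mulnC (leq_trans (_ : _ < i * 3 + 3)%N) ?ltn_add2l //.
by rewrite -[X in (_ + X)%N]mul1n -mulnDl addn1 (leq_mul2r 3 i.+1 3) /=.
Qed.
End Cramer.

(** * Central elements of the reflection equation algebra *)

Section FreeAlgebraInduction.
Import monalg.
Variables (K : comNzRingType) (X : choiceType).

(** Words span the free algebra, and a word arises from the empty one by multiplying by letters on
    the left. *)
Lemma freeAlg_ind (P : freeAlg K X -> Prop) :
    P 1 -> (forall x u, P u -> P (fgen K x * u)) ->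
    (forall u v, P u -> P v -> P (u + v)) -> (forall k u, P u -> P (k *: u)) ->
  forall u, P u.
Proof.
move=> P1 PM PD PZ u.
have Pw (w : seq X) : P << FMonom w >>.
  elim: w => [|x w IH]; first by rewrite -fmoneE.
  suff -> : << FMonom (x :: w) >> = fgen K x * << FMonom w >> :> freeAlg K X.
    exact: PM.
  have wE : mmul (fmu x) (FMonom w) = FMonom (x :: w).
    by rewrite [LHS]fmmulE fmuE.
  by rewrite [RHS]fgmulUU mul1r wE.
rewrite [u]monalgE; elim/big_ind: _ => [||w _].
  by rewrite -(scale0r 1); exact: PZ.
  exact: PD.
have -> : << u@_w *g w >> = u@_w *: << FMonom w >> :> freeAlg K X.
  by rewrite -[RHS]mul_malgC [RHS]fgmulUU mulr1 mul1m fmK.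
exact: PZ.
Qed.

(** The commutant of [z] is a subalgebra. As [f] is only a ring morphism, its linearity enters as
    the condition that it preserves scalars. *)
Lemma freeAlg_comm (A : algType K) (f : {rmorphism freeAlg K X -> A}) (z : A) :
    (forall k, f k%:A = k%:A) -> (forall x, GRing.comm z (f (fgen K x))) ->
  forall u, GRing.comm z (f u).
Proof.
move=> fK zX; elim/freeAlg_ind=> [|x u zu|u v zu zv|k u zu].
- by rewrite rmorph1; apply: commr1.
- by rewrite rmorphM; apply: commrM.
- by rewrite rmorphD; apply: commrD.
- rewrite -mulr_algl rmorphM fK; apply: commrM => //.
  exact/commr_sym/comm_alg.
Qed.
End FreeAlgebraInduction.

Section Center.
Variables (K : fieldType) (q : K).

Lemma map_re_defect (A B : algType K) (f : {rmorphism A -> B}) (L : 'M[A]_3) :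
    (forall k : K, f k%:A = k%:A) ->
  map_mx f (re_defect q L) = re_defect q (map_mx f L).
Proof.
move=> fK; rewrite /re_defect /=; set R := map_mx (in_alg A) _.
set R' := map_mx (in_alg B) _.
have <- : map_mx f R = R' by apply/matrixP => i j; rewrite !mxE fK.
have <- : map_mx f (L *t (1%:M : 'M_3)) = map_mx f L *t (1%:M : 'M_3).
  by rewrite map_mxT map_mx1.
by move: R (L *t _) => R L1; rewrite map_mxB !map_mxM.
Qed.

(** The defect of the generic matrix [freeL] has the defining relations as entries, and the
    projection maps it to the defect of [reL q]. *)
Lemma reL_re_defect : re_defect q (reL q) = 0.
Proof.
pose pi : {rmorphism freeAlg K ('I_3 * 'I_3)%type -> reAlg q} :=
  quot_pi (re_rel q).
have piL : map_mx pi (freeL K) = reL q by apply/matrixP => i j; rewrite !mxE.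
rewrite -piL -map_re_defect => [|k]; last by rewrite [LHS]quot_piZ rmorph1.
apply/matrixP => i j; rewrite mxE [RHS]mxE -[RHS](rmorph0 pi).
by apply: quot_rel; rewrite subr0; exists i, j.
Qed.

Lemma reAlg_central (z : reAlg q) :
  (forall i j, GRing.comm z (reL q i j)) -> central z.
Proof.
move=> zL x; rewrite -[x]quot_reprK.
pose pi : {rmorphism freeAlg K ('I_3 * 'I_3)%type -> reAlg q} :=
  quot_pi (re_rel q).
apply: (freeAlg_comm (f := pi)) => [k|[i j]].
  by rewrite [LHS]quot_piZ rmorph1.
by have := zL i j; rewrite mxE.
Qed.
End Center.

(** * Passage to the localization *)

(** [inv2] is total with default value 0, so genuine invertibility has to be recorded. *)
Definition has_inv2 (A : pzRingType) (x : A) : Prop :=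
  x * inv2 x = 1 /\ inv2 x * x = 1.

Lemma rmorph_inv2 (A B : pzRingType) (f : {rmorphism A -> B}) (x : A) :
  has_inv2 x -> inv2 (f x) = f (inv2 x).
Proof. by case=> xV Vx; apply: inv2P; rewrite -rmorphM ?xV ?Vx rmorph1. Qed.

Lemma rmorph_has_inv2 (A B : pzRingType) (f : {rmorphism A -> B}) (x : A) :
  has_inv2 x -> has_inv2 (f x).
Proof.
move=> xV; rewrite /has_inv2 rmorph_inv2 // -!rmorphM.
by case: xV => -> ->; rewrite rmorph1.
Qed.

Lemma rmorph_I2 (A B : pzRingType) (f : {rmorphism A -> B}) (L : 'M[A]_3) :
  has_inv2 (I1 L) -> I2 (map_mx f L) = f (I2 L).
Proof.
by move=> cV; rewrite /I2 !mxE (rmorph_inv2 f cV) rmorphB !rmorphM.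
Qed.

(** Stated without scalars, since the localization is a bare ring: [a'] stands for q^-1 a^+. *)
Lemma Y_cramer (B : pzRingType) (L : 'M[B]_3) (a' D M P : B) :
    has_inv2 (I1 L) -> has_inv2 (I2 L) ->
    L 0 1 * L 0 2 = L 0 2 * a' -> D = L 1 1 * L 0 2 - L 1 2 * a' ->
    L 0 1 * M + L 0 2 * P = L 0 0 * D -> L 1 1 * M + L 1 2 * P = L 1 0 * D ->
  Y L = L 2 0 * D - (L 2 1 * M + L 2 2 * P).
Proof.
move=> [cu uc] [sv vs] ac defD r0 r1.
have [_ NB] := I3_block_inv cu uc sv vs.
have I21 : I2 L * I1 L = D.
  (* Moving c^+ to the left of [a'] cancels its inverse. *)
  by rewrite defD /I1 /I2 mulrBl -!mulrA ac (mulrA (inv2 _)) uc mul1r.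
rewrite /Y -mulrA I21 /I3 mulrBl; congr (_ - _).
(* [D] becomes a 1 x 1 matrix, so that associativity can bring it next to the column. *)
have NMP : inv2 (I3_block L) *m
    (col_mx (L 0 0)%:M (L 1 0)%:M : 'M_(1 + 1, 1)) *m D%:M = col_mx M%:M P%:M.
  rewrite -mulmxA (_ : col_mx _ _ *m _ = I3_block L *m col_mx M%:M P%:M).
    by rewrite mulmxA NB mul1mx.
  rewrite mul_col_mx /I3_block mul_block_col -!scalar_mxM -!raddfD /=.
  by rewrite r0 r1.
transitivity (((row_mx (L 2 1)%:M (L 2 2)%:M : 'M_(1, 1 + 1))
                 *m col_mx M%:M P%:M) 0 0).
  by rewrite -NMP !mulmxA [RHS]mxE big_ord1 [D%:M _ _]mxE eqxx mulr1n.
by rewrite mul_row_col -!scalar_mxM -raddfD mxE eqxx mulr1n.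
Qed.

Lemma Y_qdet (K : fieldType) (q : K) (A : algType K) (L : 'M[A]_3)
    (B : pzRingType) (f : {rmorphism A -> B}) (fL := map_mx f L) :
    q != 0 -> re_defect q L = 0 ->
    has_inv2 (I1 fL) -> has_inv2 (I2 fL) ->
  Y fL = f (- q ^+ 2 *: qdet q L).
Proof.
move=> q0 re I1V I2V; have fE i j : fL i j = f (L i j) by rewrite mxE.
rewrite -(qdet_cramer q0 re) rmorphB rmorphD !rmorphM -!fE.
apply: (Y_cramer (a' := f (q^-1 *: L 0 1)) I1V I2V).
- by rewrite !fE -!rmorphM (entry01_entry02 q0 re).
- by rewrite !fE -!rmorphM -rmorphB.
- by rewrite !fE -!rmorphM -rmorphD (cramer_row0 q0 re).
- by rewrite !fE -!rmorphM -rmorphD (cramer_row1 q0 re).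
Qed.

(** The inverse of c^+ from the first localization survives in the second, and hence the embedding
    carries I_2 to I_2. *)
Lemma re_emb_inv (K : fieldType) (q : K) (L := map_mx (re_emb q) (reL q)) :
  has_inv2 (I1 L) /\ has_inv2 (I2 L).
Proof.
have cV : has_inv2 (I1 (reL1 q)) by rewrite /I1 mxE; exact: loc_emb_inv.
have -> : L = map_mx (loc_emb (I2 (reL1 q))) (reL1 q).
  by rewrite /L -map_mx_comp.
split; first by rewrite /I1 mxE; apply: rmorph_has_inv2.
by rewrite rmorph_I2 //; exact: loc_emb_inv.
Qed.

Lemma Y_reL (K : fieldType) (q : K) : q != 0 ->
  Y (map_mx (re_emb q) (reL q)) = re_emb q (- q ^+ 2 *: qdet q (reL q)).
Proof.
move=> q0; have [I1V I2V] := re_emb_inv q.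
exact: Y_qdet q0 (reL_re_defect q) I1V I2V.
Qed.

Theorem lemma2p4 (R : realType) (q : R[i]) (hq : q != 0) :
  let e3 := qdet q (reL q) in
  let Yloc := Y (map_mx (re_emb q) (reL q)) in
  (exists z : reAlg q, central z /\ Yloc = re_emb q z) /\
  (exists kappa : R[i],
     [/\ kappa != 0, central e3 & Yloc = re_emb q (kappa *: e3)]).
Proof.
move=> e3 Yloc.
(* Used with k = - q^2 for the preimage of Y and with k = 1 for e_3^(3) itself. *)
have e3C k : central (k *: e3).
  apply: reAlg_central => i j; apply: commr_sym; rewrite -mulr_algl.
  apply: commrM; first exact/commr_sym/comm_alg.
  by apply/commr_sym/qdet_comm => //; exact: reL_re_defect.
split; first by exists (- q ^+ 2 *: e3); split=> //; exact: Y_reL.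
exists (- q ^+ 2); split; [by rewrite oppr_eq0 expf_neq0| |exact: Y_reL].
by rewrite -[e3]scale1r.
Qed.
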